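(* For fixed irrational $q\in(0,1)$, consider the metric Polish probability space $\mathfrak{X}:=[-1,-(1-q)]\cup[0,1-q]$, equipped with its Euclidean metric $d$ and uniform probability $\mu$. Then $(\mathfrak{X},d,\mu)$ is not $(n,\epsilon,r)$-disintegrable for any $n\in\mathbb{N}$, $0<r<1-q$, and $0<\epsilon<1$. In particular, $(\mathfrak{X},d,\mu)$ is not asymptotically disintegrable for any rate.
   Context: $\mathbb{N}=\{1,2,\dots\}$ and $[n]=\{1,\dots,n\}$. A metric Polish probability space $(\mathfrak{X},d,\mu)$ consists of a Polish space $\mathfrak{X}$, a (not necessarily complete) metric $d$ generating its topology, and a Borel probability measure $\mu$. $B(x,r)=\{y\in\mathfrak{X}: d(x,y)\leq r\}$ is the closed ball. Here the uniform probability is Lebesgue measure restricted to $\mathfrak{X}$ (which has total length $1$). Given $n\in\mathbb{N}$, $\epsilon>0$, $r>0$, $(\mathfrak{X},d,\mu)$ is $(n,\epsilon,r)$-disintegrable if, whenever $X_1,\dots,X_n$ are i.i.d. with distribution $\mu$ on a probability space $(\Psi,\mathcal{F},\mathbb{P})$, with $\mathbb{P}$-probability at least $1-\epsilon$ (i.e. on some event of probability at least $1-\epsilon$) there exists a disintegration of $\mu$ along the random multifunction $x\mapsto\{i\in[n]: x\in B(X_i,r)\}$ with respect to the uniform measure on $[n]$; that is, there exist Borel probability measures $\mu_1,\dots,\mu_n$ on $\mathfrak{X}$ with $\mu_i(B(X_i,r))=1$ for all $i$ and $\mu=\frac1n\sum_{i=1}^n\mu_i$. Given functions $\epsilon,r:\mathbb{N}\rightarrow\mathbb{R}_{\geq0}$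 tending to zero as $n\rightarrow\infty$, $(\mathfrak{X},d,\mu)$ is asymptotically disintegrable with rate $(\epsilon,r)$ if for all $n$ sufficiently large it is $(n,\epsilon(n),r(n))$-disintegrable. *)

(* Defs.v *)
From HB Require Import structures.
From mathcomp Require Import all_boot all_order all_algebra.
From mathcomp Require Import ring lra.
From mathcomp Require Import all_classical all_reals all_analysis.
From mathcomp Require Import measurable_realfun.

Set Implicit Arguments.
Unset Strict Implicit.
Unset Printing Implicit Defensive.

Import Order.TTheory GRing.Theory Num.Theory.
Import numFieldNormedType.Exports.

Local Open Scope classical_set_scope.
Local Open Scope ring_scope.

(* Measurable types are pointed in MathComp-Analysis, hence so are the metric
   spaces below; this only excludes the empty space, which carries no
   probability. *)
#[short(type="pmetricType")]
HB.structure Definition PointedMetric (K : numDomainType) :=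
  {M of Metric K M & isPointed M}.

Definition separable (T : topologicalType) :=
  exists2 D : set T, countable D & dense D.

Definition complete_metric (R : realType) (M : metricType R) :=
  forall u : nat -> M, cauchy (u @ \oo) -> exists l : M, u @ \oo --> l.

Definition completely_metrizable (R : realType) (T : topologicalType) :=
  exists (M : metricType R) (f : T -> M) (g : M -> T),
    [/\ cancel f g, cancel g f, continuous f, continuous g &
        complete_metric M].

Definition polish (R : realType) (T : topologicalType) :=
  separable T /\ completely_metrizable R T.

Definition borel (T : ptopologicalType) := g_sigma_algebraType (@open T).

(* The topology of a metricType is the one generated by its distance mdist,
   which need not be complete: polish asks for some complete metric. *)
Record metricPolishProbability (R : realType) := MetricPolishProbability {
  mpp_space :> pmetricType R ;
  mpp_polish : polish R mpp_space ;
  mpp_prob : probability (borel mpp_space) R }.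

(* The library's closed_ball is the closure of the open ball, which may be
   strictly smaller. *)
Definition cball (R : realType) (M : metricType R) (x : M) (r : R) : set M :=
  [set y | mdist x y <= r].

Definition mutually_independent (R : realType) (d d' : measure_display)
    (Psi : measurableType d) (T : measurableType d')
    (P : probability Psi R) (n : nat) (X : 'I_n -> {RV P >-> T}) :=
  forall (J : {set 'I_n}) (B : 'I_n -> set T),
    (forall i, measurable (B i)) ->
    P (\bigcap_(i in [set` J]) (X i @^-1` B i)) =
      (\prod_(i in J) P (X i @^-1` B i))%E.

Definition iid (R : realType) (d d' : measure_display)
    (Psi : measurableType d) (T : measurableType d')
    (P : probability Psi R) (n : nat) (X : 'I_n -> {RV P >-> T})
    (mu : probability T R) :=
  mutually_independent X /\
  forall (i : 'I_n) (B : set T), measurable B -> distribution P (X i) B = mu B.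

Section disintegrability.
Variables (R : realType) (X : metricPolishProbability R).
Local Notation mu := (mpp_prob X).

Definition has_disintegration (n : nat) (r : R) (x : 'I_n -> X) :=
  exists nu : 'I_n -> probability (borel X) R,
    (forall i, nu i (cball (x i) r) = 1%E) /\
    (forall B : set (borel X), measurable B ->
       mu B = (n%:R^-1%:E * \sum_(i < n) nu i B)%E).

(* Meant for n, eps, r > 0; also used at eps = 0 and r = 0, since rates are
   only required to be nonnegative. *)
Definition disintegrable (n : nat) (eps r : R) :=
  forall (d : measure_display) (Psi : measurableType d)
    (P : probability Psi R) (x : 'I_n -> {RV P >-> borel X}),
    iid x mu ->
    exists E : set Psi, [/\ measurable E, ((1 - eps)%:E <= P E)%E &
      forall w, E w -> has_disintegration r (fun i => x i w)].

Definition asymptotically_disintegrable (eps r : nat -> R) :=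
  \forall n \near \oo, disintegrable n (eps n) (r n).

End disintegrability.

Definition is_rate (R : realType) (f : nat -> R) :=
  (forall n, (0 < n)%N -> 0 <= f n) /\ f @ \oo --> (0 : R).

Section set_type_metric.
Context {R : realType} {M : metricType R} (A : set M).

Let dist (x y : A) : R := mdist (\val x) (\val y).

Let dist_ge0 x y : 0 <= dist x y. Proof. exact: mdist_ge0. Qed.

Let dist_positivity x y : dist x y = 0 -> x = y.
Proof. by move=> /mdist_positivity/val_inj. Qed.

Let ballEdist (x : A) e : ball x e = [set y | dist x y < e].
Proof. by rewrite -initial_ballE ballEmdist. Qed.

HB.instance Definition _ := PseudoMetric_isMetric.Build R (set_type A)
  dist_ge0 dist_positivity ballEdist.

End set_type_metric.

(* R^o is R with its Euclidean metric, mdist x y = `|y - x|. *)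
Definition two_intervals (R : realType) (q : R) : set R^o :=
  [set` `[-1, - (1 - q)]] `|` [set` `[0, 1 - q]].

Section two_intervals_space.
Context {R : realType} (q : R) (q01 : 0 < q < 1).

(* The argument q01 only serves to infer a point of the space. *)
Definition two_intervals_type of 0 < q < 1 : Type :=
  set_type (two_intervals q).
Local Notation T := (two_intervals_type q01).

HB.instance Definition _ := Metric.copy T (set_type (two_intervals q)).

Lemma two_intervals0 : 0 \in two_intervals q.
Proof.
by apply/mem_set; right; rewrite /= in_itv/= lexx subr_ge0 ltW//; case/andP: q01.
Qed.

HB.instance Definition _ := isPointed.Build T (exist _ 0 two_intervals0).

Lemma two_intervals_closed : closed (two_intervals q : set R).
Proof. by apply: closedU; exact: itv_closed. Qed.

Lemma two_intervals_measurable : measurable (two_intervals q : set R).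
Proof. exact: measurableU. Qed.

Definition two_intervals_val (x : T) : R :=
  set_val (x : set_type (two_intervals q)).
Local Notation val := two_intervals_val.

Lemma two_intervals_valP (x : T) : two_intervals q (val x).
Proof. by apply/set_mem; exact: (valP (x : set_type (two_intervals q))). Qed.

Lemma two_intervals_val_inj : injective val.
Proof. exact: val_inj. Qed.

Lemma two_intervals_val_surj (y : R) :
  two_intervals q y -> exists x : T, val x = y.
Proof. by move=> /mem_set qy; exists (exist _ y qy). Qed.

Lemma two_intervals_val_continuous : continuous (val : T -> R).
Proof. by move=> x; exact: initial_continuous. Qed.

Lemma two_intervals_mdist (x y : T) : mdist x y = `|val y - val x|.
Proof. by []. Qed.

Lemma two_intervals_ball (x : T) (e : R) (y : T) :
  ball x e y <-> `|val x - val y| < e.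
Proof. by []. Qed.

Let rational_near (x e : R) : two_intervals q x -> 0 < e ->
  exists y : R, [/\ two_intervals q y, rational y & `|x - y| < e].
Proof.
have near (a b : R) : a < b -> x \in `[a, b] -> 0 < e ->
    exists y : R, [/\ y \in `[a, b], rational y & `|x - y| < e].
  move=> ab; rewrite in_itv/= => /andP[ax xb] e0.
  have /rat_in_itvoo[p] : Num.max a (x - e) < Num.min b (x + e).
    by rewrite gt_max !lt_min; apply/andP; split; apply/andP; split; lra.
  rewrite in_itv/= gt_max lt_min => /andP[/andP[ap xp] /andP[pb px]].
  exists (ratr p); split; [by rewrite in_itv/= !ltW|by exists p|].
  by rewrite ltr_norml; apply/andP; split; lra.
have /andP[q0 q1] := q01.
case=> /= xI e0.
- have [|y [yI yr xy]] := near _ _ _ xI e0; first by lra.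
  by exists y; split => //; left.
- have [|y [yI yr xy]] := near _ _ _ xI e0; first by lra.
  by exists y; split => //; right.
Qed.

Let two_intervals_separable : separable T.
Proof.
exists [set x : T | rational (val x)].
  rewrite -(@eq_countable _ _ [set val x | x in [set x : T | rational (val x)]]).
    apply: (@sub_countable _ _ _ (@rational R)); last first.
      by apply: (sub_countable (card_image_le _ _)); exact: countableP.
    by apply: subset_card_le => _ [x xr <-].
  by apply: inj_card_eq => x y _ _; exact: two_intervals_val_inj.
move=> O [x Ox] oO.
have /nbhs_ballP[e/= e0 eO] : nbhs x O by exact: open_nbhs_nbhs.
have [_ [/two_intervals_val_surj[y <-] yr xy]] :=
  rational_near (two_intervals_valP x) e0.
by exists y; split => //; exact: eO.
Qed.

Let two_intervals_complete : complete_metric T.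
Proof.
move=> u cu.
have cvu : cvg (val \o u @ \oo).
  apply: cauchy_cvg.
  apply/cauchy_ballP => e e0.
  have /cauchy_ballP/(_ e e0)[[A B]/= [uA uB] AB] := cu.
  exists (val @` A, val @` B) => /=; last first.
    by move=> [_ _] [/= [x Ax <-] [y By <-]]; exact: (AB (x, y)).
  split.
  - by apply: (@filterS _ \oo _ (u @^-1` A) _ _ uA) => n /= An; exists (u n).
  - by apply: (@filterS _ \oo _ (u @^-1` B) _ _ uB) => n /= Bn; exists (u n).
have ql : two_intervals q (lim (val \o u @ \oo)).
  apply: (@closed_cvg _ R \oo _ (val \o u) (two_intervals q) _ _ _ cvu).
    exact: two_intervals_closed.
  by apply: nearW => n; exact: two_intervals_valP.
have [l vl] := two_intervals_val_surj ql.
exists l; apply/cvg_ballP => e e0.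
move/cvg_ballP : cvu => /(_ e e0); apply: filterS => n.
by rewrite -vl.
Qed.

Lemma two_intervals_polish : polish R T.
Proof.
split; first exact: two_intervals_separable.
exists T, id, id; split=> [//|//|x //|x //|].
exact: two_intervals_complete.
Qed.

Lemma two_intervals_image_measurable (B : set (borel T)) :
  measurable B -> measurable (val @` B).
Proof.
move: B; apply: smallest_sub => [|B oB].
- split => [|B mB|F mF] /=.
  + by rewrite image_set0.
  + rewrite (_ : _ @` _ = two_intervals q `\` val @` B); last first.
      apply/seteqP; split => [_ [x [_ Bx] <-]|y [/two_intervals_val_surj[x <-] nB]].
        split; first exact: two_intervals_valP.
        by move=> [z Bz /two_intervals_val_inj zx]; apply: Bx; rewrite -zx.
      by exists x => //; split => // Bx; apply: nB; exists x.
    by apply: measurableD => //; exact: two_intervals_measurable.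
  + by rewrite image_bigcup; exact: bigcupT_measurable.
- have [U oU <-] : exists2 U : set R, open U & val @^-1` U = B by exact: oB.
  rewrite (_ : _ @` _ = U `&` two_intervals q); last first.
    apply/seteqP; split => [_ [x Ux <-]|y [Uy /two_intervals_val_surj[x xy]]].
      by split => //; exact: two_intervals_valP.
    by exists x => //=; rewrite xy.
  apply: measurableI; first exact: open_measurable.
  exact: two_intervals_measurable.
Qed.

Definition two_intervals_uniform (B : set (borel T)) : \bar R :=
  lebesgue_measure (val @` B).
Local Notation mu := two_intervals_uniform.

Let uniform0 : mu set0 = 0%E.
Proof. by rewrite /mu image_set0 measure0. Qed.

Let uniform_ge0 B : (0 <= mu B)%E. Proof. exact: measure_ge0. Qed.

Let uniform_sigma_additive : semi_sigma_additive mu.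
Proof.
move=> F mF tF mUF; rewrite /mu image_bigcup.
apply: measure_sigma_additive.
  by move=> i; exact: two_intervals_image_measurable.
apply/trivIsetP => i j _ _ ij; rewrite -subset0 => _ [[x Fix <-]].
move=> [y Fjy /two_intervals_val_inj yx].
move/trivIsetP : tF => /(_ i j I I ij); rewrite -subset0; apply.
by split; [exact: Fix|rewrite -yx].
Qed.

HB.instance Definition _ := isMeasure.Build _ _ _ mu
  uniform0 uniform_ge0 uniform_sigma_additive.

Let uniform_setT : mu setT = 1%E.
Proof.
have /andP[q0 q1] := q01.
rewrite /mu (_ : _ @` _ = two_intervals q); last first.
  apply/seteqP; split => [_ [x _ <-]|y /two_intervals_val_surj[x <-]].
    exact: two_intervals_valP.
  by exists x.
rewrite /two_intervals measureU//; last first.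
  rewrite -subset0 => x [] /=; rewrite !in_itv/= => /andP[_ h1] /andP[h2 _].
  by have := le_trans h2 h1; lra.
transitivity (lebesgue_measure ([set` `[-1, - (1 - q)]%R] : set R) +
              lebesgue_measure ([set` `[0, 1 - q]%R] : set R))%E; first by [].
rewrite !lebesgue_measure_itv/= !lte_fin.
rewrite !ifT; [|lra|lra].
by rewrite -!EFinD; congr EFin; ring.
Qed.

HB.instance Definition _ := Measure_isProbability.Build _ _ _ mu uniform_setT.

Definition two_intervals_space : metricPolishProbability R :=
  MetricPolishProbability two_intervals_polish mu.

End two_intervals_space.

(* Main.v *)
Require Import Defs.
From mathcomp Require Import all_boot all_order all_algebra.
From mathcomp Require Import lra.
From mathcomp Require Import all_classical all_reals all_analysis.

Import Order.TTheory GRing.Theory Num.Theory.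
Local Open Scope ring_scope.
Local Open Scope classical_set_scope.

(** The two intervals are at distance [1 - q], so for [r < 1 - q] a closed ball
of radius [r] lies entirely in the interval of its center.  Suppose that [mu] is
the average of probability measures [nu i] carried by the balls of radius [r]
around points [x i].  Each [nu i] then gives the left interval mass one or zero,
according to whether it contains [x i], and averaging shows that the left
interval has mass [k / n], with [k] the number of the [x i] in it
([isolated_set_frequency]).  But that mass is its length [q]
([left_interval_mass]), which is irrational.  So no configuration of points
whatsoever, random or not, admits a disintegration ([no_disintegration]).

An event on which disintegrations exist is therefore empty, and cannot have
probability at least [1 - eps > 0].  This refutes disintegrability only if there
is some i.i.d. sample of law [mu] to which the definition applies; such a sample
lives on an iterated product of [mu] ([iid_exists]). *)

Section iid_existence.
Context {R : realType} {d' : measure_display} {T : measurableType d'}.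
Variable mu : probability T R.

(** The product rule for the full family of indices gives the one for a
subfamily, by taking the remaining sets to be the whole space; singleton
subfamilies then give the marginal laws. *)
Lemma iidP (d : measure_display) (Psi : measurableType d)
    (P : probability Psi R) (n : nat) (X : 'I_n -> {RV P >-> T}) :
  (forall B : 'I_n -> set T, (forall i, measurable (B i)) ->
     P (\bigcap_i (X i @^-1` B i)) = (\prod_(i < n) mu (B i))%E) ->
  iid X mu.
Proof.
move=> PX.
have PXJ (J : {set 'I_n}) (B : 'I_n -> set T) : (forall i, measurable (B i)) ->
    P (\bigcap_(i in [set` J]) (X i @^-1` B i)) = (\prod_(i in J) mu (B i))%E.
  move=> mB; pose C i := if i \in J then B i else setT.
  have mC i : measurable (C i) by rewrite /C; case: ifP.
  rewrite (_ : \bigcap_(i in _) _ = \bigcap_i (X i @^-1` C i)).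
    rewrite PX// [RHS]big_mkcond/=; apply: eq_bigr => i _.
    by rewrite /C; case: ifP => // _; exact: probability_setT.
  apply/seteqP; split => w Bw i /=.
  - by rewrite /C; case: ifP => // iJ _; exact: Bw.
  - by move=> iJ; have := Bw i I; rewrite /= /C; move: iJ => /= ->.
have PX1 i B : measurable B -> P (X i @^-1` B) = mu B.
  move=> mB; have := PXJ [set i]%SET (fun=> B) (fun=> mB).
  rewrite big_set1 => <-; congr (P _); apply/seteqP; split => w /=.
  - by move=> Bw j /set1P ->.
  - by apply; exact/set11.
split => [J B mB|i B mB]; last exact: PX1.
by rewrite PXJ//; apply: eq_bigr => i _; rewrite PX1.
Qed.

(** By induction on [n]: the sample space is multiplied by a copy of [T] whose
coordinate becomes the new variable, and the product rule over all indices is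
the value of the product measure on a rectangle. *)
Lemma iid_exists (n : nat) :
  exists (d : measure_display) (Psi : measurableType d)
    (P : probability Psi R) (X : 'I_n -> {RV P >-> T}), iid X mu.
Proof.
suff [d [Psi [P [X PX]]]] : exists (d : measure_display)
    (Psi : measurableType d) (P : probability Psi R) (X : 'I_n -> {RV P >-> T}),
    forall B : 'I_n -> set T, (forall i, measurable (B i)) ->
      P (\bigcap_i (X i @^-1` B i)) = (\prod_(i < n) mu (B i))%E.
  by exists d, Psi, P, X; exact: iidP.
elim: n => [|n [d [Psi [P [X PX]]]]].
  (* An empty family lives on any probability space; the functions chosen here
     are never evaluated. *)
  exists _, T, mu, (fun=> mfun_Sub (mem_set (@measurable_id _ T setT))) => B mB.
  rewrite big_ord0 (_ : \bigcap_i _ = setT) ?probability_setT//.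
  by apply/seteqP; split => // w _ [].
pose Y (i : 'I_n.+1) : Psi * T -> T :=
  if unlift ord0 i is Some j then X j \o fst else snd.
have mY i : measurable_fun setT (Y i).
  rewrite /Y; case: (unlift ord0 i) => [j|]; last exact: measurable_snd.
  by apply: measurableT_comp => //; exact: measurable_fst.
exists _, (Psi * T)%type, (P \x mu)%E,
  (fun i => mfun_Sub (mem_set (mY i))) => B mB.
rewrite (_ : \bigcap_i _ =
    (\bigcap_i (X i @^-1` B (lift ord0 i))) `*` B ord0); last first.
  apply/seteqP; split => [[w t] Bwt|[w t] [/= Bw Bt] i _ /=].
  - split => /=.
    + by move=> i _; have := Bwt (lift ord0 i) I; rewrite /= /Y liftK.
    + by have := Bwt ord0 I; rewrite /= /Y unlift_none.
  - by rewrite /Y; case: unliftP => [j|] ->//=; exact: Bw.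
rewrite [LHS]product_measure1E//.
  rewrite big_ord_recl muleC; congr (_ * _)%E.
  exact: (PX (fun i => B (lift ord0 i))).
apply: fin_bigcap_measurable => // i _.
by rewrite -[_ @^-1` _]setTI; exact: measurable_funP.
Qed.

End iid_existence.

Section isolated_set.
Context {R : realType} {X : metricPolishProbability R}.
Local Notation mu := (mpp_prob X).

Lemma cball_measurable (x : X) (r : R) :
  measurable (cball x r : set (borel X)).
Proof.
rewrite -[cball x r]setCK; apply: measurableC; apply: sub_sigma_algebra => /=.
rewrite openE => y /= /negP; rewrite -ltNge => rxy.
apply/nbhs_ballP; exists (mdist x y - r) => /=; first by rewrite subr_gt0.
move=> z; rewrite ballEmdist /= => yz; apply/negP; rewrite -ltNge.
have := metric_triangle x z y; rewrite (metric_sym z y); lra.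
Qed.

(** If no point of [L] is within [r] of a point outside [L], then each ball of
radius [r] is contained in [L] or disjoint from it, so each of
the disintegrating measures gives [L] mass one or zero, and the mass of [L] is the proportion of centers in [L]. *)
Lemma isolated_set_frequency (n : nat) (r : R) (x : 'I_n -> X) (L : set X) :
  measurable (L : set (borel X)) ->
  (forall y z, mdist y z <= r -> L y <-> L z) ->
  has_disintegration r x ->
  mu L = (n%:R^-1 * (\sum_(i < n) (x i \in L))%:R)%:E.
Proof.
move=> mL isoL [nu [nu1 ->//]].
rewrite EFinM natr_sum -sumEFin; congr (_ * _)%E; apply: eq_bigr => i _.
have mass1 (A : set X) : measurable (A : set (borel X)) ->
    cball (x i) r `<=` A -> nu i A = 1%E.
  move=> mA xA; apply/eqP; rewrite eq_le probability_le1//= -(nu1 i).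
  by apply: le_measure => //; rewrite inE//; exact: cball_measurable.
have [/set_mem Lx|/negP Lx] := boolP (x i \in L).
  by rewrite mass1// => y /isoL[+ _]; exact.
rewrite -[L]setCK probability_setC; last exact: measurableC.
rewrite mass1 ?subee//; first exact: measurableC.
by move=> y /isoL[_ Lxy] /Lxy /mem_set.
Qed.

End isolated_set.

Section two_intervals_disintegration.
Context {R : realType} {q : R} (q01 : 0 < q < 1).
Local Notation X := (two_intervals_space q01).

(** In [two_intervals q] the points of [[-1, -(1 - q)]] are the negative ones;
this description makes the set visibly open. *)
Definition left_interval : set X :=
  [set x | (two_intervals_val x < 0)%R].

Lemma left_interval_measurable : measurable (left_interval : set (borel X)).
Proof.
apply: sub_sigma_algebra; rewrite /left_interval.
have : open (@two_intervals_val R q q01 @^-1` [set y | y < 0]).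
  apply: open_comp; last exact: open_lt.
  by move=> x _; exact: two_intervals_val_continuous.
exact.
Qed.

Lemma left_interval_isolated (r : R) (y z : X) : r < 1 - q ->
  mdist y z <= r -> left_interval y <-> left_interval z.
Proof.
have /andP[q0 q1] := q01.
have := two_intervals_valP y; have := two_intervals_valP z.
rewrite two_intervals_mdist /two_intervals /left_interval /= !in_itv/=.
move=> zI yI rq; rewrite ler_norml => /andP[yz1 yz2].
by split; case: zI => /andP[? ?]; case: yI => /andP[? ?]; lra.
Qed.

Lemma left_interval_mass : mpp_prob X left_interval = q%:E.
Proof.
have /andP[q0 q1] := q01.
rewrite /= /two_intervals_uniform.
rewrite (_ : _ @` _ = [set` `[-1, - (1 - q)]%R]).
  rewrite lebesgue_measure_itv/= lte_fin ifT; last lra.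
  by rewrite -EFinD; congr EFin; lra.
apply/seteqP; split => [_ [x x0 <-]|y /= yI].
  have := two_intervals_valP x; rewrite /two_intervals/=.
  move: x0; rewrite /left_interval/= => x0 [//|].
  by rewrite in_itv/= => /andP[]; lra.
have [|x xy] := @two_intervals_val_surj R q q01 y; first by left.
exists x => //; rewrite /left_interval/= xy.
by move: yI; rewrite in_itv/= => /andP[_]; lra.
Qed.

Lemma no_disintegration (n : nat) (r : R) (x : 'I_n -> X) :
  irrational q -> r < 1 - q -> ~ has_disintegration r x.
Proof.
move=> qirr rq.
move=> /(isolated_set_frequency _ _ _ _ left_interval_measurable
  (fun y z => left_interval_isolated r y z rq)).
rewrite left_interval_mass => -[qE]; apply: qirr; apply/rationalP.
exists (\sum_(i < n) (x i \in left_interval))%N, n.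
by rewrite [LHS]qE mulrC.
Qed.

(** The bounds on [r] and [eps] are exactly what the terms of a rate satisfy
eventually; such terms may well be zero. *)
Lemma not_disintegrable (n : nat) (eps r : R) :
  irrational q -> r < 1 - q -> eps < 1 -> ~ disintegrable X n eps r.
Proof.
move=> qirr rq eps1 dis.
have [d [Psi [P [x xiid]]]] := iid_exists (mpp_prob X) n.
have [E [_ PE Edis]] := dis d Psi P x xiid.
have E0 : E = set0.
  by rewrite -subset0 => w /Edis; exact: no_disintegration.
by move: PE; rewrite E0 measure0 lee_fin; lra.
Qed.

End two_intervals_disintegration.

Theorem proposition3p5 (R : realType) (q : R) (q01 : 0 < q < 1)
    (qirr : irrational q) :
  (forall (n : nat) (eps r : R), (0 < n)%N -> 0 < r < 1 - q -> 0 < eps < 1 ->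
     ~ disintegrable (two_intervals_space q01) n eps r) /\
  (forall eps r : nat -> R, is_rate eps -> is_rate r ->
     ~ asymptotically_disintegrable (two_intervals_space q01) eps r).
Proof.
have /andP[_ q1] := q01.
split=> [n eps r _ /andP[_ rq] /andP[_ eps1]|eps r [_ eps0] [_ r0] dis].
  exact: not_disintegrable.
suff: \forall n \near \oo, False by move=> /filter_ex[].
near=> n.
apply: (@not_disintegrable R q q01 n (eps n) (r n)) => //.
- near: n; apply: (cvgr_lt _ r0); lra.
- near: n; apply: (cvgr_lt _ eps0); lra.
- by near: n.
Unshelve. all: by end_near.
Qed.
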